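(* Let $\mathbf A\in\mathbb H^{m\times n}$, $\mathbf y\in\mathbb H^{m\times 1}$, and let $\mathbf x^{0}=(x^0_1,\dots,x^0_n)^T$ be the least squares solution of least norm of the right system $\mathbf A\mathbf x=\mathbf y$. Put $\mathbf f=\mathbf A^{*}\mathbf y$. (i) If $\operatorname{rank}\mathbf A=n$, then for all $j=1,\dots,n$, $x_j^0=\dfrac{\operatorname{cdet}_j\big((\mathbf A^{*}\mathbf A)_{.j}(\mathbf f)\big)}{\operatorname{ddet}\mathbf A}$. (ii) If $\operatorname{rank}\mathbf A=k\le m<n$, then for all $j=1,\dots,n$, $x_j^0=\dfrac{\sum_{\beta\in J_{k,n}\{j\}}\operatorname{cdet}_j\Big(\big((\mathbf A^{*}\mathbf A)_{.j}(\mathbf f)\big)^{\beta}_{\beta}\Big)}{\sum_{\beta\in J_{k,n}}\big|(\mathbf A^{*}\mathbf A)^{\beta}_{\beta}\big|}$.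
   Context: $\mathbb H$ is the quaternion skew field, $\mathbf A^*$ the conjugate transpose. The rank of a quaternion matrix is the maximal number of right-linearly independent columns. For $\mathbf x\in\mathbb H^{n\times1}$, $\|\mathbf x\|=\sqrt{\mathbf x^*\mathbf x}$. The least squares solution of least norm of $\mathbf A\mathbf x=\mathbf y$ is the vector $\mathbf x^0$ of minimal norm among all $\tilde{\mathbf x}$ minimizing $\|\mathbf A\tilde{\mathbf x}-\mathbf y\|$. $\operatorname{ddet}\mathbf A:=\det(\mathbf A^*\mathbf A)$. Row and column determinants of $\mathbf M=(m_{ij})\in\mathbb H^{n\times n}$: $\operatorname{rdet}_i\mathbf M=\sum_{\sigma\in S_n}(-1)^{n-r}m_{i\,i_{k_1}}m_{i_{k_1}i_{k_1+1}}\cdots m_{i_{k_1+l_1}\,i}\cdots m_{i_{k_r}i_{k_r+1}}\cdots m_{i_{k_r+l_r}i_{k_r}}$ with $\sigma=(i\,i_{k_1}\dots i_{k_1+l_1})(i_{k_2}\dots i_{k_2+l_2})\cdots(i_{k_r}\dots i_{k_r+l_r})$ its decomposition into $r$ disjoint cycles (fixed points included), first cycle starting with $i$, other cycles starting with their smallest element, $i_{k_2}<\dots<i_{k_r}$; $\operatorname{cdet}_j\mathbf M=\sum_{\tau\in S_n}(-1)^{n-r}m_{j_{k_r}j_{k_r+l_r}}\cdots m_{j_{k_r+1}j_{k_r}}\cdots m_{j\,j_{k_1+l_1}}\cdots m_{j_{k_1+1}j_{k_1}}m_{j_{k_1}j}$ with $\tau=(j_{k_r+l_r}\dots j_{k_r})\cdots(j_{k_2+l_2}\dots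 j_{k_2})(j_{k_1+l_1}\dots j_{k_1}\,j)$, the rightmost cycle ending with $j$, other cycles ending on the right with their smallest element, $j_{k_2}<\dots<j_{k_r}$. For Hermitian $\mathbf M$ all these coincide and are real; the common value is $\det\mathbf M$. $\mathbf M_{.j}(\mathbf f)$ is $\mathbf M$ with its $j$th column replaced by $\mathbf f$. $L_{k,n}$ is the set of strictly increasing $k$-sequences from $\{1,\dots,n\}$, $J_{k,n}=L_{k,n}$, $J_{k,n}\{j\}=\{\beta\in L_{k,n}: j\in\beta\}$. $\mathbf M^{\beta}_{\beta}$ is the principal submatrix with rows and columns in $\beta$; $|\mathbf M^\beta_\beta|=\det\mathbf M^\beta_\beta$ for Hermitian $\mathbf M$. In $\operatorname{cdet}_j(\mathbf N^\beta_\beta)$, $j\in\beta$, the subscript refers to the column of the submatrix coming from column $j$ of $\mathbf N$. *)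

(* Defs.v *)
Set Warnings "-notation-overridden,-redundant-canonical-projection,-ambiguous-paths".
From HB Require Import structures.
From mathcomp Require Import all_boot all_order all_algebra all_fingroup.
From mathcomp Require Import boolp reals.
From mathcomp Require Import ring.
Set Implicit Arguments. Unset Strict Implicit. Unset Printing Implicit Defensive.
Import Order.TTheory GRing.Theory Num.Theory.
Local Open Scope ring_scope.

Section Quaternion.
Variable R : realType.

Record quat := Quat { qre : R; qi : R; qj : R; qk : R }.

Definition quat2tup (q : quat) := (qre q, qi q, qj q, qk q).
Definition tup2quat (t : R * R * R * R) := let: (a, b, c, d) := t in Quat a b c d.
Lemma quat2tupK : cancel quat2tup tup2quat. Proof. by case. Qed.

HB.instance Definition _ := Equality.copy quat (can_type quat2tupK).
HB.instance Definition _ := Choice.copy quat (can_type quat2tupK).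

Definition qzero := Quat 0 0 0 0.
Definition qone := Quat 1 0 0 0.
Definition qopp (p : quat) := Quat (- qre p) (- qi p) (- qj p) (- qk p).
Definition qadd (p q : quat) :=
  Quat (qre p + qre q) (qi p + qi q) (qj p + qj q) (qk p + qk q).
(* Hamilton product: i^2 = j^2 = k^2 = ijk = -1 *)
Definition qmul (p q : quat) :=
  Quat (qre p * qre q - qi p * qi q - qj p * qj q - qk p * qk q)
       (qre p * qi q + qi p * qre q + qj p * qk q - qk p * qj q)
       (qre p * qj q - qi p * qk q + qj p * qre q + qk p * qi q)
       (qre p * qk q + qi p * qj q - qj p * qi q + qk p * qre q).

Lemma quat_eq (p q : quat) :
  qre p = qre q -> qi p = qi q -> qj p = qj q -> qk p = qk q -> p = q.
Proof. by case: p q => ? ? ? ? [? ? ? ?] /= -> -> -> ->. Qed.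

Lemma qaddA : associative qadd.
Proof. by move=> p q r; apply: quat_eq => /=; ring. Qed.
Lemma qaddC : commutative qadd.
Proof. by move=> p q; apply: quat_eq => /=; ring. Qed.
Lemma qadd0 : left_id qzero qadd.
Proof. by move=> p; apply: quat_eq => /=; ring. Qed.
Lemma qaddN : left_inverse qzero qopp qadd.
Proof. by move=> p; apply: quat_eq => /=; ring. Qed.

HB.instance Definition _ := GRing.isZmodule.Build quat qaddA qaddC qadd0 qaddN.

Lemma qmulA : associative qmul.
Proof. by move=> p q r; apply: quat_eq => /=; ring. Qed.
Lemma qmul1 : left_id qone qmul.
Proof. by move=> p; apply: quat_eq => /=; ring. Qed.
Lemma qmulr1 : right_id qone qmul.
Proof. by move=> p; apply: quat_eq => /=; ring. Qed.
Lemma qmulDl : left_distributive qmul +%R.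
Proof. by move=> p q r; apply: quat_eq => /=; ring. Qed.
Lemma qmulDr : right_distributive qmul +%R.
Proof. by move=> p q r; apply: quat_eq => /=; ring. Qed.
Lemma qone_neq0 : qone != 0.
Proof. by apply/eqP => /(congr1 qre) /= /eqP; rewrite oner_eq0. Qed.

HB.instance Definition _ :=
  GRing.Zmodule_isNzRing.Build quat qmulA qmul1 qmulr1 qmulDl qmulDr qone_neq0.

Definition qconj (p : quat) := Quat (qre p) (- qi p) (- qj p) (- qk p).
Definition qnorm2 (p : quat) : R := qre p ^+ 2 + qi p ^+ 2 + qj p ^+ 2 + qk p ^+ 2.
(* p^-1 = conj p / |p|^2 (and 0^-1 = 0, never used) *)
Definition qinv (p : quat) : quat :=
  let c := (qnorm2 p)^-1 in
  Quat (qre p * c) (- qi p * c) (- qj p * c) (- qk p * c).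

End Quaternion.

Arguments qre {R}. Arguments qconj {R}. Arguments qinv {R}.

Section QMatrix.
Variable R : realType.
Local Notation H := (quat R).

Definition qadj m n (A : 'M[H]_(m, n)) : 'M[H]_(n, m) := map_mx qconj A^T.

(* ||x|| = sqrt (x^* x)  (x^* x is a 1x1 matrix with real entry) *)
Definition qvnorm p (x : 'cV[H]_p) : R := Num.sqrt (qre ((qadj x *m x) 0 0)).

Definition right_indep m n (A : 'M[H]_(m, n)) (S : {set 'I_n}) : Prop :=
  forall a : 'I_n -> H,
    (forall r : 'I_m, \sum_(j in S) A r j * a j = 0) ->
    forall j, j \in S -> a j = 0.

Definition qrank m n (A : 'M[H]_(m, n)) : nat :=
  \max_(S : {set 'I_n} | `[< right_indep A S >]) #|S|.

Definition is_lsq m n (A : 'M[H]_(m, n)) (y : 'cV[H]_m) (x : 'cV[H]_n) : Prop :=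
  forall x' : 'cV[H]_n, qvnorm (A *m x - y) <= qvnorm (A *m x' - y).
Definition is_lsq_least_norm m n (A : 'M[H]_(m, n)) (y : 'cV[H]_m)
    (x0 : 'cV[H]_n) : Prop :=
  is_lsq A y x0 /\ forall x, is_lsq A y x -> qvnorm x0 <= qvnorm x.

Definition colrep n (M : 'M[H]_n) (j : 'I_n) (f : 'cV[H]_n) : 'M[H]_n :=
  \matrix_(r, c) if c == j then f r 0 else M r c.

Definition cycprod n (M : 'M[H]_n) (s : 'S_n) (a : 'I_n) : H :=
  \prod_(t < #|porbit s a|) M ((s ^+ t)%g a) ((s ^+ t.+1)%g a).

Definition cycmins n (s : 'S_n) : seq 'I_n :=
  [seq a <- enum 'I_n | [forall b in porbit s a, (a <= b)%N]].

Definition cycsign n (s : 'S_n) : H := (-1) ^+ (n - #|porbits s|).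

Definition rdet n (i : 'I_n) (M : 'M[H]_n) : H :=
  \sum_(s : 'S_n) cycsign s *
     (cycprod M s i * \prod_(a <- cycmins s | a \notin porbit s i) cycprod M s a).

(* cdet_j: the cycles not containing j, each starting (= ending on the right,
   in the paper's notation) with its smallest element, in decreasing order of
   these elements, and rightmost the cycle of j, starting with j *)
Definition cdet n (j : 'I_n) (M : 'M[H]_n) : H :=
  \sum_(s : 'S_n) cycsign s *
     ((\prod_(a <- rev (cycmins s) | a \notin porbit s j) cycprod M s a)
       * cycprod M s j).

(* determinant of a Hermitian matrix: the common value of all rdet_i/cdet_j;
   we take the formula with all cycles starting at their minimum, in
   increasing order, which is literally rdet_1 when n >= 1 (1 is the minimum
   of its own cycle) and the empty product 1 when n = 0 *)
Definition hdet n (M : 'M[H]_n) : H :=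
  \sum_(s : 'S_n) cycsign s * \prod_(a <- cycmins s) cycprod M s a.

Definition ddet m n (A : 'M[H]_(m, n)) : H := hdet (qadj A *m A).

Definition psubmx n (M : 'M[H]_n) (beta : {set 'I_n}) : 'M[H]_#|beta| :=
  \matrix_(i, j) M (enum_val i) (enum_val j).

(* cdet_j (M^beta_beta) for j in beta, the index referring to the column of
   the submatrix coming from column j of M (0 if j is not in beta; unused) *)
Definition subcdet n (j : 'I_n) (M : 'M[H]_n) (beta : {set 'I_n}) : H :=
  if [pick i : 'I_#|beta| | enum_val i == j] is Some i
  then cdet i (psubmx M beta) else 0.

End QMatrix.

(* Main.v *)
(** For a Hermitian matrix [M], reversing a cycle of a permutation conjugates the
corresponding cycle product, so averaging over reversals replaces every cycle
product by its real part.  Hence the principal minors of [M] are real numbers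
[subdet M g], and [cdet_j] of a principal block with column [j] replaced by [f]
is [subcof M g j f], a linear form in [f] with real weights on all cycles
avoiding [j].

Splitting the cycle of [j] at a vertex [i] by the transposition [(i j)] gives the
Laplace rules: the form [subcof M g j] sends column [j] of [M] to [subdet M g] and
the other columns of index in [g] to [0], and the cofactor of [i <> j] in [g] is
minus the value on column [i] of the form of [g] without [i].

Let [G = A^* A].  The vector [v] of conjugate cofactors of row [j] of the block [g]
satisfies [|A v|^2 = subdet G g * subdet G (g without j)].  By induction
the minor of [g] is positive if the columns of [A] in [g] are independent, and
otherwise it is zero and [v] lies in the kernel of [A].

The solution [x0] satisfies [G x0 = A^* y] and is orthogonal to the kernel of
[A].  Expanding [subcof G b j (G x0)] over all [b] of size [k = rank A] containing
[j], the terms with columns outside [b] are cofactors of sets of size [k + 1]; they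
add up to [x0_j] times the minors of the [k]-sets that avoid [j], because
[x0] is orthogonal to the vectors [v] of the sets of size [k + 1]. *)

Require Import Defs.
Set Warnings "-notation-overridden,-redundant-canonical-projection,-ambiguous-paths".
From HB Require Import structures.
From mathcomp Require Import all_boot all_order all_algebra all_fingroup.
From mathcomp Require Import boolp reals.
From mathcomp Require Import ring lra.
Import Order.TTheory GRing.Theory Num.Theory.
Local Open Scope ring_scope.
Set Implicit Arguments. Unset Strict Implicit. Unset Printing Implicit Defensive.

(** * Quaternions: central real scalars, conjugation and norm *)

Section QuaternionAlgebra.
Variable R : realType.
Local Notation H := (quat R).

Definition qr (x : R) : H := Quat x 0 0 0.

Fact qr_is_zmod_morphism : zmod_morphism qr.
Proof. by move=> x y; apply: quat_eq => /=; ring. Qed.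
HB.instance Definition _ :=
  GRing.isZmodMorphism.Build R H qr qr_is_zmod_morphism.

Fact qr_is_monoid_morphism : monoid_morphism qr.
Proof. by split=> // x y; apply: quat_eq => /=; ring. Qed.
HB.instance Definition _ :=
  GRing.isMonoidMorphism.Build R H qr qr_is_monoid_morphism.

Fact qconj_is_zmod_morphism : zmod_morphism (@qconj R).
Proof. by move=> x y; apply: quat_eq => /=; ring. Qed.
HB.instance Definition _ :=
  GRing.isZmodMorphism.Build H H (@qconj R) qconj_is_zmod_morphism.

Fact qre_is_zmod_morphism : zmod_morphism (@qre R).
Proof. by []. Qed.
HB.instance Definition _ :=
  GRing.isZmodMorphism.Build H R (@qre R) qre_is_zmod_morphism.

Lemma qr_inj : injective qr. Proof. by move=> x y []. Qed.

Lemma qrC (x : R) (q : H) : qr x * q = q * qr x.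
Proof. by apply: quat_eq => /=; ring. Qed.

Lemma qr_qinv (x : R) : qinv (qr x) = qr x^-1.
Proof.
rewrite /qinv /qnorm2 /= !expr0n /= !addr0 oppr0 !mul0r.
apply: quat_eq => //=; have [->|x0] := eqVneq x 0; first by rewrite invr0 mul0r.
by rewrite expr2 invfM mulrA divff// mul1r.
Qed.

Lemma qconjK : involutive (@qconj R).
Proof. by move=> q; apply: quat_eq => /=; ring. Qed.

Lemma qconjM (p q : H) : qconj (p * q) = qconj q * qconj p.
Proof. by apply: quat_eq => /=; ring. Qed.

Lemma qconj_qr (x : R) : qconj (qr x) = qr x.
Proof. by apply: quat_eq => /=; ring. Qed.

Lemma qre_conj (q : H) : qre (qconj q) = qre q. Proof. by []. Qed.

(** The trace property that makes the real part of a cycle product independent of the starting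
    vertex. *)
Lemma qreC (p q : H) : qre (p * q) = qre (q * p).
Proof. by rewrite /=; ring. Qed.

Lemma qaddconj (q : H) : q + qconj q = qr (qre q) + qr (qre q).
Proof. by apply: quat_eq => /=; ring. Qed.

Lemma qconjmul (q : H) : qconj q * q = qr (qnorm2 q).
Proof. by apply: quat_eq; rewrite /qnorm2 /=; ring. Qed.

Lemma qnorm2_ge0 (q : H) : 0 <= qnorm2 q.
Proof. by rewrite /qnorm2 !addr_ge0// sqr_ge0. Qed.

Lemma qnorm2_eq0 (q : H) : (qnorm2 q == 0) = (q == 0).
Proof.
apply/eqP/eqP => [|->]; last by rewrite /qnorm2 /= expr0n /= !addr0.
move/eqP; rewrite /qnorm2 !paddr_eq0 ?addr_ge0 ?sqr_ge0// !sqrf_eq0.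
by move=> /andP[/andP[/andP[/eqP a /eqP b] /eqP c] /eqP d]; apply: quat_eq.
Qed.

Lemma qr_mul_eq0 (x : R) (q : H) : qr x * q = 0 -> x = 0 \/ q = 0.
Proof.
move=> xq; have [->|x0] := eqVneq x 0; [by left | right].
by rewrite -[q]mul1r -[1]/(qr 1) -(mulVf x0) rmorphM -mulrA xq mulr0.
Qed.

(** Removes the factor 2 that appears when a sum over permutations is added to its image under an
    involution. *)
Lemma qdouble_inj (p q : H) : p + p = q + q -> p = q.
Proof.
have dE (z : H) : z + z = qr 2 * z by apply: quat_eq => /=; ring.
move=> /eqP; rewrite !dE -subr_eq0 -mulrBr => /eqP/qr_mul_eq0[/eqP|/eqP].
  by rewrite pnatr_eq0.
by rewrite subr_eq0 => /eqP.
Qed.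

Lemma qconj_prod_ord n (F : 'I_n -> H) :
  qconj (\prod_(t < n) F t) = \prod_(t < n) qconj (F (rev_ord t)).
Proof.
elim: n F => [|n IH] F; first by rewrite !big_ord0 (qconj_qr 1).
rewrite big_ord_recr qconjM IH big_ord_recl /=; congr (qconj (F _) * _).
  by apply: val_inj; rewrite /= subn1.
by apply: eq_bigr => t _; congr (qconj (F _)); apply: val_inj; rewrite /= /bump /=.
Qed.

(** Definiteness of the norm; the equality case later turns a vanishing Gram form into membership in
    the kernel of [A]. *)
Lemma qre_sum_conj_mul_ge0 (I : finType) (F : I -> H) :
  0 <= qre (\sum_i qconj (F i) * F i) ?= iff [forall i, F i == 0].
Proof.
have -> : qre (\sum_i qconj (F i) * F i) = \sum_i qnorm2 (F i).
  by rewrite raddf_sum; apply: eq_bigr => i _; rewrite qconjmul.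
split; first by apply: sumr_ge0 => i _; exact: qnorm2_ge0.
rewrite eq_sym psumr_eq0 => [|i _]; last exact: qnorm2_ge0.
apply/allP/forallP => [h i|h i _].
  by rewrite -qnorm2_eq0; exact: h (mem_index_enum i).
by rewrite qnorm2_eq0 h.
Qed.

End QuaternionAlgebra.

(** * Reversing, merging and splitting cycles of a permutation *)

Section CycleSurgery.
Local Open Scope group_scope.
Variable T : finType.
Implicit Types (s u : {perm T}) (a b x : T).

Lemma expgSx s t a : (s ^+ t.+1) a = s ((s ^+ t) a).
Proof. by rewrite expgSr permM. Qed.

Lemma porbit_next s a x : (s x \in porbit s a) = (x \in porbit s a).
Proof.
by have := porbit_perm s 1 x; rewrite expg1 -!eq_porbit_mem => ->.
Qed.

Lemma porbit_prev s a x : (s^-1 x \in porbit s a) = (x \in porbit s a).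
Proof. by rewrite -porbit_next permKV. Qed.

Lemma expg_porbit s a : (s ^+ #|porbit s a|) a = a.
Proof. by rewrite permX iter_porbit. Qed.

Lemma expg_pred_porbit s a : (s ^+ #|porbit s a|.-1) a = s^-1 a.
Proof.
apply: (@perm_inj _ s); rewrite permKV -expgSx prednK ?expg_porbit//.
by rewrite lt0n card_porbit_neq0.
Qed.

Lemma expg_porbit_neq s a t : (0 < t < #|porbit s a|)%N -> (s ^+ t) a != a.
Proof.
case/andP; case: t => // t _ lt; apply/eqP => e.
have := uniq_traject_porbit s a.
rewrite -(prednK (leq_trans (ltn0Sn _) lt)) /= => /andP[/negP[]].
rewrite -{1}e permX iterSr; apply/trajectP; exists t => //.
by rewrite -ltnS prednK//; exact: leq_trans (ltn0Sn _) lt.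
Qed.

Lemma porbit_min_sub s a (A : {set T}) :
  a \in A -> {in A, forall x, s x \in A} -> porbit s a \subset A.
Proof.
move=> aA sA; apply/subsetP => x /porbitP[t ->].
by elim: t => [|t IH]; rewrite ?expg0 ?perm1// expgSx sA.
Qed.

Section Agree.
Variables (s u : {perm T}) (a : T).
Hypothesis agree : {in porbit s a, u =1 s}.

Lemma expg_agree t : (u ^+ t) a = (s ^+ t) a.
Proof.
by elim: t => [|t IH]; rewrite ?expg0// !expgSx IH agree// mem_porbit.
Qed.

Lemma porbit_agree : porbit u a = porbit s a.
Proof.
by apply/setP => x; apply/porbitP/porbitP => -[t ->]; exists t;
  rewrite expg_agree.
Qed.

(** The inverse at [a] is a forward power, with exponent the orbit size minus one, so agreement
    along the orbit suffices. *)
Lemma permV_agree : u^-1 a = s^-1 a.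
Proof. by rewrite -!expg_pred_porbit porbit_agree expg_agree. Qed.
End Agree.

Definition revcycle_fun s a x := if x \in porbit s a then s^-1 x else s x.

Fact revcycle_inj s a : injective (revcycle_fun s a).
Proof.
move=> x z; rewrite /revcycle_fun.
case: ifPn => xO; case: ifPn => zO.
- exact: perm_inj.
- by move=> e; move: zO; rewrite -porbit_next -e porbit_prev xO.
- by move=> e; move: xO; rewrite -porbit_next e porbit_prev zO.
- exact: perm_inj.
Qed.

Definition revcycle a s := perm (@revcycle_inj s a).

Lemma revcycle_in s a x : x \in porbit s a -> revcycle a s x = s^-1 x.
Proof. by rewrite permE /revcycle_fun => ->. Qed.

Lemma revcycle_out s a x : x \notin porbit s a -> revcycle a s x = s x.
Proof. by rewrite permE /revcycle_fun => /negPf->. Qed.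

Lemma revcycle_agree s a b : b \notin porbit s a ->
  {in porbit s b, revcycle a s =1 s}.
Proof.
move=> ba x xb; rewrite revcycle_out//; apply: contra ba => xa.
by rewrite -eq_porbit_mem in xa; rewrite -(eqP xa) porbit_sym.
Qed.

Lemma expg_revcycle s a t : (revcycle a s ^+ t) a = (s^-1 ^+ t) a.
Proof.
apply: expg_agree => x; rewrite porbitV => xa.
by rewrite revcycle_in.
Qed.

Lemma porbit_revcycle s a b : porbit (revcycle a s) b = porbit s b.
Proof.
have [ba|] := boolP (b \in porbit s a); last by move/revcycle_agree/porbit_agree.
have aE : porbit (revcycle a s) a = porbit s a.
  by rewrite -[RHS]porbitV; apply: porbit_agree => x; rewrite porbitV => /revcycle_in.
have : b \in porbit (revcycle a s) a by rewrite aE.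
by rewrite -eq_porbit_mem => /eqP ->; rewrite aE; apply/esym/eqP; rewrite eq_porbit_mem.
Qed.

Lemma revcycleK a : involutive (revcycle a).
Proof.
move=> s; apply/permP => x.
have [xa|xa] := boolP (x \in porbit s a); last first.
  by rewrite !revcycle_out// porbit_revcycle.
rewrite revcycle_in ?porbit_revcycle//.
by apply: (@perm_inj _ (revcycle a s)); rewrite permKV revcycle_in ?porbit_next// permK.
Qed.

(** Parity is read off the number of orbits, and a reversal keeps every orbit as a set. *)
Lemma odd_revcycle a s : revcycle a s = s :> bool.
Proof.
rewrite /odd_perm; congr (_ (+) odd #|pred_of_set _|).
by apply: eq_imset => x; exact: porbit_revcycle.
Qed.

Lemma perm_on_revcycle (g : {set T}) a s :
  perm_on g (revcycle a s) = perm_on g s.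
Proof.
suff sub u : perm_on g u -> perm_on g (revcycle a u).
  by apply/idP/idP => [/sub|/sub//]; rewrite revcycleK.
move=> ug; apply/subsetP => x /=; rewrite inE.
have [xa|xa] := boolP (x \in porbit u a).
  by rewrite revcycle_in//; apply: contraR => /(out_perm (perm_onV ug)) ->.
by rewrite revcycle_out//; apply: contraR => /(out_perm ug) ->.
Qed.

Section SplitCycle.
Variables (i j : T) (s : {perm T}).
Hypothesis ij : i \notin porbit s j.
(** Permutations compose from left to right: [u] applies [s] and then exchanges [i] and [j]. The
    predecessor of [j] is redirected to [i] and that of [i] to [j], which joins the two cycles. *)
Let u := s * tperm i j.

Lemma merge_out x : s x != i -> s x != j -> u x = s x.
Proof. by move=> xi xj; rewrite permM tpermD// eq_sym. Qed.

Lemma expg_merge_l t : (t < #|porbit s j|)%N -> (u ^+ t) j = (s ^+ t) j.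
Proof.
elim: t => [|t IH] lt; first by rewrite !expg0.
rewrite !expgSx IH; last exact: ltnW.
rewrite merge_out// -?expgSx; first by apply: contraNneq ij => <-; exact: mem_porbit.
by rewrite expg_porbit_neq.
Qed.

Lemma expg_merge_mid : (u ^+ #|porbit s j|) j = i.
Proof.
have c0 : (0 < #|porbit s j|)%N by rewrite lt0n card_porbit_neq0.
rewrite -(prednK c0) expgSx expg_merge_l; last by rewrite prednK.
by rewrite expg_pred_porbit permM permKV tpermR.
Qed.

Lemma mergeV : u^-1 j = s^-1 i.
Proof. by apply: (@perm_inj _ u); rewrite permKV permM permKV tpermL. Qed.

Lemma merge_agree a : a \notin porbit s i -> a \notin porbit s j ->
  {in porbit s a, u =1 s}.
Proof.
move=> ai aj x xa; rewrite merge_out//.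
  by apply: contraNneq ai => <-; rewrite porbit_sym porbit_next.
by apply: contraNneq aj => <-; rewrite porbit_sym porbit_next.
Qed.
End SplitCycle.

Section MergeCycles.
Variables (i j : T) (s : {perm T}).
Hypothesis ij : i \notin porbit s j.
Let u := s * tperm i j.

Lemma expg_merge_r t : (t < #|porbit s i|)%N ->
  (u ^+ (#|porbit s j| + t)) j = (s ^+ t) i.
Proof.
move=> lt; rewrite expgD permM expg_merge_mid// /u tpermC expg_merge_l//.
by rewrite porbit_sym.
Qed.

Lemma porbit_merge : porbit u j = porbit s j :|: porbit s i.
Proof.
apply/eqP; rewrite eqEsubset; apply/andP; split.
  apply: porbit_min_sub; first by rewrite inE porbit_id.
  move=> x; rewrite /u permM; case: tpermP => [||_ _]; rewrite !inE ?porbit_id ?orbT//.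
  by rewrite !porbit_next.
apply/subsetP => x; rewrite inE => /orP[]; rewrite porbit_traject => /trajectP[t lt ->].
  by rewrite -permX -(expg_merge_l ij)// mem_porbit.
by rewrite -permX -expg_merge_r// mem_porbit.
Qed.

Lemma card_porbit_merge : #|porbit u j| = (#|porbit s j| + #|porbit s i|)%N.
Proof.
rewrite porbit_merge cardsU; suff -> : porbit s j :&: porbit s i = set0.
  by rewrite cards0 subn0.
apply/setP => x; rewrite !inE; apply: contraNF ij => /andP[].
by rewrite -!eq_porbit_mem => /eqP <-; rewrite eq_sym.
Qed.

Lemma odd_merge : u = ~~ s :> bool.
Proof.
rewrite odd_permM odd_tperm addbC; suff -> : i != j by [].
by apply: contraNneq ij => ->; rewrite porbit_id.
Qed.
End MergeCycles.

(** If [i] were on the cycle of [j] both before and after the multiplication, the number of orbits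
    would rise by one each time the transposition is applied, although applying it twice restores
    [s]. *)
Lemma split_porbit i j s : i != j ->
  (i \in porbit (s * tperm i j) j) = (i \notin porbit s j).
Proof.
have mul_tperm u : i != j -> i \in porbit u j -> i \notin porbit (u * tperm i j) j.
  have count v : (#|porbits (v * tperm i j)| + (i \notin porbit v j).*2
                   = #|porbits v| + (i != j))%N.
    (* Passing to inverses keeps the orbits and moves the transposition from the left factor to the
       right one. *)
    have := porbits_mul_tperm v^-1 i j.
    by rewrite /= -{1}[tperm i j]tpermV -invMg !porbitsV porbitV.
  move=> ij iu; apply/negP => iut; have := count (u * tperm i j).
  have := count u; rewrite -mulgA tperm2 mulg1 iu iut ij /= !addn0 => -> /eqP.
  by rewrite -addnA -{1}[#|_|]addn0 eqn_add2l.
move=> ij; apply/idP/idP => [iut|].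
  by have := mul_tperm _ ij iut; rewrite -mulgA tperm2 mulg1.
by move=> iNs; rewrite porbit_merge// inE porbit_id orbT.
Qed.
End CycleSurgery.

(** * Products of matrix entries along a cycle *)

Section CycleProducts.
Variables (R : realType) (n : nat).
Local Notation H := (quat R).
Implicit Types (M : 'M[H]_n) (s u : 'S_n) (a b i j : 'I_n) (f : 'cV[H]_n).

(** The cycle product at [a] without its closing entry, the only one that lies in column [a]. *)
Definition wprod M s a : H :=
  \prod_(t < #|porbit s a|.-1) M ((s ^+ t)%g a) ((s ^+ t.+1)%g a).

Lemma cycprod_wprod M s a : cycprod M s a = wprod M s a * M ((s^-1)%g a) a.
Proof.
have recr N (F : nat -> H) : (0 < N)%N ->
    \prod_(t < N) F t = (\prod_(t < N.-1) F t) * F N.-1.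
  by case: N => // N _; rewrite big_ord_recr.
have c0 : (0 < #|porbit s a|)%N by rewrite lt0n card_porbit_neq0.
rewrite /cycprod (recr _ (fun t => M ((s ^+ t)%g a) ((s ^+ t.+1)%g a)))//.
by rewrite prednK// expg_porbit expg_pred_porbit.
Qed.

Lemma cycprod_agree M s u a :
  {in porbit s a, u =1 s} -> cycprod M u a = cycprod M s a.
Proof.
move=> su; rewrite /cycprod (porbit_agree su).
by apply: eq_bigr => t _; rewrite !(expg_agree su).
Qed.

Lemma wprod_agree M s u a :
  {in porbit s a, u =1 s} -> wprod M u a = wprod M s a.
Proof.
move=> su; rewrite /wprod (porbit_agree su).
by apply: eq_bigr => t _; rewrite !(expg_agree su).
Qed.

(** The walk from [j] returns to column [j] only at its last step, so the new column enters once, as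
    the rightmost factor. *)
Lemma cycprod_colrep M s j f :
  cycprod (colrep M j f) s j = wprod M s j * f ((s^-1)%g j) 0.
Proof.
rewrite cycprod_wprod mxE eqxx; congr (_ * _); apply: eq_bigr => t _.
rewrite mxE (negPf (expg_porbit_neq _))//=.
by rewrite (leq_ltn_trans (ltn_ord t))// prednK// lt0n card_porbit_neq0.
Qed.

Lemma cycprod_colrep_out M s j f a : a \notin porbit s j ->
  cycprod (colrep M j f) s a = cycprod M s a.
Proof.
move=> aj; apply: eq_bigr => t _; rewrite mxE ifN//.
by apply: contraNneq aj => <-; rewrite porbit_sym mem_porbit.
Qed.

(** Conjugation reverses the order of the factors and, by hermiticity, swaps the indices of each
    one, so the same walk is run backwards. *)
Lemma cycprod_revcycle M s a : (forall i j, M i j = qconj (M j i)) ->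
  cycprod M (revcycle a s) a = qconj (cycprod M s a).
Proof.
move=> hM; rewrite /cycprod qconj_prod_ord porbit_revcycle.
have back t : (t <= #|porbit s a|)%N ->
    (revcycle a s ^+ t)%g a = (s ^+ (#|porbit s a| - t))%g a.
  move=> le; rewrite expg_revcycle -{1}(expg_porbit s a) -{1}(subnK le).
  by rewrite expgD !permM expVgn permK.
apply: eq_bigr => t _; rewrite -hM !back ?(ltnW (ltn_ord t))//.
by rewrite /= subnSK.
Qed.

Lemma cycprod_revcycle_out M s a b : b \notin porbit s a ->
  cycprod M (revcycle a s) b = cycprod M s b.
Proof. by move/revcycle_agree/cycprod_agree->. Qed.

Lemma qre_cycprod_next M s a : qre (cycprod M s (s a)) = qre (cycprod M s a).
Proof.
rewrite /cycprod; have -> : porbit s (s a) = porbit s a.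
  by have := porbit_perm s 1 a; rewrite expg1.
have := expg_porbit s a; have := card_porbit_neq0 s a.
case: #|porbit s a| => // N _ sN.
rewrite [in LHS]big_ord_recr [in RHS]big_ord_recl qreC; congr (qre (_ * _)).
  by apply: eq_bigr => t _; rewrite -!permM -!expgS.
rewrite /= -!permM -!expgS sN (expgSr _ N.+1) permM sN.
by rewrite !expg0 !perm1 ?expg1.
Qed.

Lemma qre_cycprod_porbit M s a b : b \in porbit s a ->
  qre (cycprod M s b) = qre (cycprod M s a).
Proof.
move=> /porbitP[t ->]; elim: t => [|t IH]; first by rewrite expg0 perm1.
by rewrite expgSx qre_cycprod_next.
Qed.

(** The merged walk follows the cycle of [j], crosses to [i] instead of closing, and then follows
    the cycle of [i] up to its closing entry. *)
Lemma wprod_merge M s i j : i \notin porbit s j ->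
  wprod M (s * tperm i j)%g j =
    wprod M s j * M ((s^-1)%g j) i * wprod M s i.
Proof.
move=> ij; rewrite /wprod card_porbit_merge//.
have c0 : (0 < #|porbit s i|)%N by rewrite lt0n card_porbit_neq0.
have := expg_pred_porbit s j; have := expg_merge_mid ij.
have := @expg_merge_l _ _ _ _ ij; have := @expg_merge_r _ _ _ _ ij.
have := card_porbit_neq0 s j; case: #|porbit s j| => // N _ Hr Hl Hm HN.
have -> : ((N.+1 + #|porbit s i|).-1 = N.+1 + #|porbit s i|.-1)%N.
  by rewrite -{1}(prednK c0) addnS.
rewrite big_split_ord /= big_ord_recr /=; congr (_ * _ * _).
- by apply: eq_bigr => t _; rewrite !Hl//= ?ltnS// ltnW// ltnS.
- by rewrite Hm Hl// -HN.
- apply: eq_bigr => t _; rewrite -addnS.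
  have lt : (t.+1 < #|porbit s i|)%N by have := ltn_ord t; rewrite -ltnS prednK.
  by rewrite !Hr// ltnW.
Qed.

Definition cyclemin s : pred 'I_n :=
  fun a => [forall b in porbit s a, (a <= b)%N].

Lemma cyclemin_agree s u a : porbit u a = porbit s a ->
  cyclemin u a = cyclemin s a.
Proof. by rewrite /cyclemin => ->. Qed.

(** The cycle of [i] has exactly one minimum, and the real part of the cycle product is the same at
    every vertex of the cycle. *)
Lemma prod_cyclemin_porbit M s (g : {set 'I_n}) i :
  perm_on g s -> i \in g ->
  \prod_(a in g | cyclemin s a && (a \in porbit s i)) qre (cycprod M s a)
    = qre (cycprod M s i).
Proof.
move=> sg ig.
case: (@arg_minnP _ i (mem (porbit s i)) val) => [|/= m mi m_min].
  exact: porbit_id.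
rewrite (big_pred1 m) ?(qre_cycprod_porbit _ mi)// => a /=.
apply/idP/eqP => [/and3P[_ /forall_inP amin ai]|->].
  apply/val_inj/anti_leq; rewrite m_min// andbT amin//.
  by rewrite -eq_porbit_mem in ai; rewrite (eqP ai).
rewrite mi andbT; apply/andP; split.
  by apply: (subsetP (porbit_min_sub ig _)) mi => x xg; rewrite perm_closed.
have mE : porbit s m = porbit s i by apply/eqP; rewrite eq_porbit_mem.
by apply/forall_inP => b; rewrite mE; exact: m_min.
Qed.

End CycleProducts.

(** * Principal minors and cofactors over index sets, with their Laplace rules *)

Section SubsetDeterminants.
Variables (R : realType) (n : nat) (M : 'M[quat R]_n).
Hypothesis hermM : forall i j, M i j = qconj (M j i).
Local Notation H := (quat R).
Implicit Types (s u : 'S_n) (a b i j : 'I_n) (f : 'I_n -> H) (g : {set 'I_n}).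

(** Both sums are doubled rather than cut into pairs, so fixed points of [phi] need no separate
    treatment. *)
Lemma eq_sum_involution (P : pred 'S_n) (phi : 'S_n -> 'S_n) (F G : 'S_n -> H) :
  involutive phi -> (forall s, P (phi s) = P s) ->
  (forall s, P s -> F s + F (phi s) = G s + G (phi s)) ->
  \sum_(s | P s) F s = \sum_(s | P s) G s.
Proof.
move=> phiK Pphi FG; apply: qdouble_inj.
have shift (E : 'S_n -> H) : \sum_(s | P s) E s = \sum_(s | P s) E (phi s).
  by rewrite (reindex_inj (inv_inj phiK)); apply: eq_bigl => s; rewrite Pphi.
by rewrite {2}(shift F) {2}(shift G) -!big_split; apply: eq_bigr.
Qed.

(** The sum runs over permutations of all indices supported in [g]; thus [g] can grow or shrink
    while the matrix stays the same. *)
Definition subdet g : R :=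
  \sum_(s | perm_on g s)
    (-1) ^+ s * \prod_(a in g | cyclemin s a) qre (cycprod M s a).

Definition outer_weight g j s : R :=
  (-1) ^+ s *
  \prod_(a in g | cyclemin s a && (a \notin porbit s j)) qre (cycprod M s a).

(** Here [f] is any function on the indices: a unit vector yields a cofactor, a column of [M] a
    Laplace expansion. *)
Definition subcof g j f : H :=
  \sum_(s | perm_on g s)
    qr (outer_weight g j s) * (wprod M s j * f ((s^-1)%g j)).

Lemma cyclemin_revcycle s a b : cyclemin (revcycle a s) b = cyclemin s b.
Proof. exact/cyclemin_agree/porbit_revcycle. Qed.

Lemma outer_weight_revcycle g j s :
  outer_weight g j (revcycle j s) = outer_weight g j s.
Proof.
rewrite /outer_weight odd_revcycle; congr (_ * _); apply: eq_big => a.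
  by rewrite cyclemin_revcycle porbit_revcycle.
case/and3P=> _ _; rewrite porbit_revcycle => aj.
by rewrite cycprod_revcycle_out.
Qed.

Lemma prod_cyclemin_split g s j : perm_on g s -> j \in g ->
  (-1) ^+ s * \prod_(a in g | cyclemin s a) qre (cycprod M s a)
    = outer_weight g j s * qre (cycprod M s j).
Proof.
move=> sg jg; rewrite (bigID (fun a => a \in porbit s j)) /= /outer_weight.
rewrite -mulrA [X in _ = _ * X]mulrC; congr (_ * (_ * _)).
  rewrite -(prod_cyclemin_porbit M sg jg).
  by apply: eq_bigl => a; rewrite andbA.
by apply: eq_bigl => a; rewrite andbA.
Qed.

(** With column [j] in place of [f] the walk from [j] closes up; averaging over the reversal of this
    cycle leaves its real part. *)
Lemma subcof_diag g j : j \in g ->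
  subcof g j (fun a => M a j) = qr (subdet g).
Proof.
move=> jg; rewrite /subdet rmorph_sum.
under [RHS]eq_bigr => s sg do rewrite /= (prod_cyclemin_split sg jg) rmorphM.
apply: (eq_sum_involution (revcycleK j)) => [s|s sg].
  exact: perm_on_revcycle.
rewrite -!cycprod_wprod outer_weight_revcycle cycprod_revcycle// qre_conj.
by rewrite -!mulrDr qaddconj.
Qed.

(* A permutation [s] with [i] off the cycle of [j] is paired with [s * tperm i j],
   whose cycle through [j] runs along the cycle of [j] and then that of [i]. *)
Lemma subcof_split g i j f : i \in g -> j \in g -> i != j ->
  subcof g j f =
  \sum_(s | perm_on g s && (i \notin porbit s j))
   qr ((-1) ^+ s * \prod_(a in g | cyclemin s a && (a \notin porbit s j)
                         && (a \notin porbit s i)) qre (cycprod M s a)) *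
   (qr (qre (cycprod M s i)) * (wprod M s j * f ((s^-1)%g j))
     - wprod M s j * M ((s^-1)%g j) i * wprod M s i * f ((s^-1)%g i)).
Proof.
move=> ig jg ij; rewrite /subcof (bigID (fun s => i \notin porbit s j)) /=.
have tg : perm_on g (tperm i j).
  apply: subset_trans (tperm_on i j) _.
  by apply/subsetP => x; rewrite !inE => /orP[] /eqP->.
rewrite [X in _ + X](reindex_inj (mulIg (tperm i j))) /=.
have cond s : perm_on g (s * tperm i j)%g && ~~ (i \notin porbit (s * tperm i j)%g j)
              = perm_on g s && (i \notin porbit s j).
  rewrite negbK split_porbit//; congr (_ && _); apply/idP/idP => [|sg].
    by move/perm_onM => /(_ _ tg); rewrite -mulgA tperm2 mulg1.
  exact: perm_onM.
rewrite (eq_bigl _ _ cond) -big_split /=; apply: eq_bigr => s /andP[sg ijs].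
rewrite mulrBr; congr (_ + _).
  rewrite [RHS]mulrA -rmorphM; congr (qr _ * _).
  rewrite /outer_weight -mulrA; congr (_ * _).
  (* The cycle of [i] does not meet that of [j]; its real part is taken out of the weight. *)
  rewrite (bigID (fun a => a \in porbit s i)) /= mulrC; congr (_ * _).
    by apply: eq_bigl => a; rewrite !andbA.
  rewrite -(prod_cyclemin_porbit M sg ig); apply: eq_bigl => a.
  rewrite -!andbA; do 2!congr (_ && _).
  have [ai|//] := boolP (a \in porbit s i); last by rewrite andbF.
  rewrite andbT; apply: contra ijs => aj.
  by rewrite -!eq_porbit_mem in ai aj *; rewrite -(eqP ai).
(* For the merged partner the parity is opposite, whence the minus sign, and the cycles off [j] are
   those of [s] that avoid both [i] and [j]. *)
rewrite mergeV wprod_merge// -mulNr -rmorphN -mulNr; congr (qr _ * _).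
rewrite /outer_weight odd_merge// porbit_merge// -signrN; congr (_ * _).
have agree a : a \notin porbit s j -> a \notin porbit s i ->
    {in porbit s a, (s * tperm i j)%g =1 s}.
  by move=> aj ai; exact: merge_agree.
apply: eq_big => a.
  rewrite inE negb_or; case: (a \in g) => //=.
  have [aj|aj] := boolP (a \in porbit s j); first by rewrite /= ?andbF.
  have [ai|ai] := boolP (a \in porbit s i); first by rewrite /= ?andbF.
  by rewrite (cyclemin_agree (porbit_agree (agree _ aj ai))) !andbT.
rewrite inE negb_or => /and4P[_ _ aj ai].
by rewrite (cycprod_agree _ (agree _ aj ai)).
Qed.

(** With column [i] in place of [f], the bracket of [subcof_split] is [qr (qre c) * W - W * c],
    where [c] is the cycle product at [i]. Reversing the cycle of [i] conjugates [c] and keeps [W],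
    so the two brackets cancel. *)
Lemma subcof_offdiag g i j : i \in g -> j \in g -> i != j ->
  subcof g j (fun a => M a i) = 0.
Proof.
move=> ig jg ij; rewrite (subcof_split _ ig jg ij).
transitivity (\sum_(s | perm_on g s && (i \notin porbit s j)) (0 : H)); last first.
  by rewrite big1.
apply: (@eq_sum_involution _ _ _ (fun=> 0) (revcycleK i)) => s.
  by rewrite perm_on_revcycle porbit_revcycle.
case/andP=> sg ijs; rewrite addr0.
have ji : j \notin porbit s i by rewrite porbit_sym.
rewrite (wprod_agree M (revcycle_agree ji)) (permV_agree (revcycle_agree ji)).
rewrite -![_ * wprod M _ i * _]mulrA -!cycprod_wprod cycprod_revcycle// qre_conj.
rewrite odd_revcycle; set w := \prod_(a in g | _) _.
have -> : \prod_(a in g | cyclemin (revcycle i s) a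
     && (a \notin porbit (revcycle i s) j)
     && (a \notin porbit (revcycle i s) i)) qre (cycprod M (revcycle i s) a) = w.
  apply: eq_big => a; first by rewrite cyclemin_revcycle !porbit_revcycle.
  by case/and3P=> _ _; rewrite porbit_revcycle => ai; rewrite cycprod_revcycle_out.
rewrite -mulrDr; set W := wprod M s j * _; set c := cycprod M s i.
suff -> : qr (qre c) * W - W * c + (qr (qre c) * W - W * qconj c) = 0.
  by rewrite mulr0.
by rewrite addrACA -opprD -(mulrDr W c) qaddconj mulrDr qrC subrr.
Qed.

Lemma perm_on_setD1 g i s : perm_on (g :\ i) s = perm_on g s && (s i == i).
Proof.
apply/idP/andP => [sgi|[sg /eqP si]].
  split; last by rewrite (out_perm sgi)// !inE eqxx.
  exact: subset_trans sgi (subsetDl _ _).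
apply/subsetP => x; rewrite !inE => sx; apply/andP; split.
  by apply: contraNneq sx => ->; rewrite si.
by apply: contraR sx => /(out_perm sg) ->.
Qed.

Lemma porbit_fix s i : s i = i -> porbit s i = [set i].
Proof.
move=> si; apply/eqP; rewrite eqEsubset sub1set porbit_id andbT.
by apply: porbit_min_sub; rewrite ?set11// => x /set1P->; rewrite si set11.
Qed.

Lemma wprod_fix s i : s i = i -> wprod M s i = 1.
Proof. by move=> si; rewrite /wprod porbit_fix// cards1 big_ord0. Qed.

Lemma permV_fixE s i : ((s^-1)%g i == i) = (s i == i).
Proof. by rewrite -(inj_eq (@perm_inj _ s)) permKV eq_sym. Qed.

(** In [subcof_split] the unit vector at [i] kills the first term, since [i] is off the cycle of
    [j], and keeps the second only if [s] fixes [i]. What remains is the walk from [j] closed by an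
    entry of column [i]. *)
Lemma subcof_remove g i j : i \in g -> j \in g -> i != j ->
  subcof g j (fun a => (a == i)%:R) = - subcof (g :\ i) j (fun a => M a i).
Proof.
move=> ig jg ij; rewrite (subcof_split _ ig jg ij) /subcof -sumrN.
have prevF s : i \notin porbit s j -> ((s^-1)%g j == i) = false.
  by apply: contraNF => /eqP <-; rewrite porbit_prev porbit_id.
rewrite (bigID (fun s => s i == i)) /= [X in _ + X]big1 ?addr0; last first.
  move=> s /andP[/andP[_ ijs] si].
  by rewrite permV_fixE (negPf si) prevF// !mulr0 subr0 mulr0.
apply: eq_big => [s|s /andP[/andP[sg ijs] /eqP si]].
  rewrite perm_on_setD1; have [si|] := eqVneq (s i) i; last by rewrite !andbF.
  by rewrite !andbT porbit_sym porbit_fix// inE eq_sym ij andbT.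
rewrite permV_fixE si eqxx (wprod_fix si) prevF// !mulr1 !mulr0 sub0r mulrN.
congr (- (qr (_ * _) * _)).
apply: eq_bigl => a; rewrite (porbit_fix si) !inE.
by case: (a \in g); case: (a == i); rewrite ?andbF ?andbT.
Qed.

Lemma subcof_minor g j : j \in g ->
  subcof g j (fun a => (a == j)%:R) = qr (subdet (g :\ j)).
Proof.
move=> jg; rewrite /subcof /subdet rmorph_sum (bigID (fun s => s j == j)) /=.
rewrite [X in _ + X]big1 ?addr0; last first.
  by move=> s /andP[_ sj]; rewrite permV_fixE (negPf sj) !mulr0.
apply: eq_big => [s|s /andP[_ /eqP sj]]; first by rewrite perm_on_setD1.
rewrite permV_fixE sj eqxx (wprod_fix sj) !mulr1; congr (qr (_ * _)).
apply: eq_bigl => a; rewrite (porbit_fix sj) !inE.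
by case: (a \in g); case: (a == j); rewrite ?andbF ?andbT.
Qed.

Lemma subcof_linear g j f : j \in g ->
  subcof g j f = \sum_(l in g) subcof g j (fun a => (a == l)%:R) * f l.
Proof.
move=> jg; rewrite /subcof; under [RHS]eq_bigr do rewrite mulr_suml.
rewrite exchange_big /=; apply: eq_bigr => s sg.
rewrite (bigD1 ((s^-1)%g j)) /=; last by rewrite perm_closed// perm_onV.
rewrite eqxx mulr1 mulrA big1 ?addr0// => l /andP[_ /negPf].
by rewrite eq_sym => ->; rewrite !mulr0 mul0r.
Qed.

Lemma subdet0 : subdet set0 = 1.
Proof.
rewrite /subdet (big_pred1 1%g) => [|s].
  by rewrite big_pred0 ?odd_perm1 ?mulr1// => a; rewrite inE.
apply/idP/eqP => [s0|->]; last exact: perm_on1.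
by apply: (perm_on_id s0); rewrite cards0.
Qed.
End SubsetDeterminants.

(** * From quaternionic determinants to sums with real cycle weights *)

Section Realization.
Variables (R : realType) (n : nat) (M : 'M[quat R]_n).
Hypothesis hermM : forall i j, M i j = qconj (M j i).
Local Notation H := (quat R).
Implicit Types (s u : 'S_n) (a b i j : 'I_n).

Lemma cycsignE s : cycsign R s = qr ((-1) ^+ s).
Proof.
rewrite rmorphXn rmorphN rmorph1 /cycsign -signr_odd /odd_perm card_ord oddB//.
(* There are at most [n] orbits, so the truncated subtraction in [cycsign] is exact. *)
by have := leq_imset_card (porbit s) 'I_n; rewrite card_ord.
Qed.

(* The cycle products are made real one starting point at a time, by averaging
   over the reversal of the cycle at that point. *)
Lemma sum_cycprod_real (l : 'S_n -> seq 'I_n) (X : 'S_n -> H) :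
  (forall a s, l (revcycle a s) = l s) ->
  (forall s, uniq (l s)) ->
  (forall s a b, a \in l s -> b \in l s -> b \in porbit s a -> b = a) ->
  (forall s a, a \in l s -> X (revcycle a s) = X s) ->
  \sum_(s : 'S_n) cycsign R s * ((\prod_(a <- l s) cycprod M s a) * X s) =
  \sum_(s : 'S_n) qr ((-1) ^+ s * \prod_(a <- l s) qre (cycprod M s a)) * X s.
Proof.
move=> l_rev l_uniq l_orb X_rev.
(* A hybrid product, real at the starting points below [k]; the passage from [k] to [k.+1] uses the
   reversal at the vertex [k]. *)
pose mix k s : H := \prod_(a <- l s)
  if (a < k)%N then qr (qre (cycprod M s a)) else cycprod M s a.
have mix0 s : mix 0 s = \prod_(a <- l s) cycprod M s a by [].
have mixn s : mix n s = qr (\prod_(a <- l s) qre (cycprod M s a)).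
  by rewrite rmorph_prod; apply: eq_bigr => a _; rewrite ltn_ord.
under eq_bigr do rewrite cycsignE -mix0.
under [RHS]eq_bigr do rewrite rmorphM /= -mixn -mulrA.
suff step k : (k <= n)%N -> \sum_(s : 'S_n) qr ((-1) ^+ s) * (mix 0 s * X s) =
    \sum_(s : 'S_n) qr ((-1) ^+ s) * (mix k s * X s) by exact: step.
elim: k => // k IH lt_kn; rewrite IH 1?ltnW//; pose c := Ordinal lt_kn.
apply: (eq_sum_involution (revcycleK c)) => // s _.
rewrite odd_revcycle -!mulrDr; congr (_ * _).
have [cl|cl] := boolP (c \in l s); last first.
  have same u : c \notin l u -> mix k.+1 u = mix k u.
    move=> cu; apply: eq_big_seq => a au.
    rewrite ltnS leq_eqVlt -[k]/(c : nat) val_eqE.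
    by case: eqVneq au cu => [->->|].
  by rewrite !same// l_rev.
rewrite !X_rev// -!mulrDl; congr (_ * _).
(* The factors do not commute, so the list is cut at [c]: all other starting points lie on other
   cycles, and the reversal affects only the middle factor. *)
have [l1 [l2 lE]] : exists l1 l2, l s = l1 ++ c :: l2.
  by case/splitPr: (cl) => l1 l2; exists l1, l2.
pose mixl q u (r : seq 'I_n) : H := \prod_(a <- r)
  if (a < q)%N then qr (qre (cycprod M u a)) else cycprod M u a.
have /andP[cl1 cl2] : (c \notin l1) && (c \notin l2).
  have := l_uniq s; rewrite lE cat_uniq /= => /and3P[_ /norP[-> _] /andP[->]] //.
have out a : a \in l1 ++ l2 -> a \notin porbit s c /\ (a == c) = false.
  move=> al; have ac : (a == c) = false.
    by apply/eqP => ac; move: al; rewrite ac mem_cat (negPf cl1) (negPf cl2).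
  split=> //; apply/negP => aO; have als : a \in l s.
    by rewrite lE mem_cat in_cons orbCA -mem_cat al orbT.
  by have /eqP := l_orb s c a cl als aO; rewrite ac.
have mixE u q : l u = l s ->
    mix q u = mixl q u l1 * ((if (c < q)%N then qr (qre (cycprod M u c))
                              else cycprod M u c) * mixl q u l2).
  by move=> lu; rewrite /mix lu lE big_cat big_cons.
have mixlS r u : {subset r <= l1 ++ l2} -> mixl k.+1 u r = mixl k u r.
  move=> rl; apply: eq_big_seq => a /rl/out[_ ac].
  by rewrite ltnS leq_eqVlt -[k]/(c : nat) val_eqE ac.
have mixl_rev r q : {subset r <= l1 ++ l2} -> mixl q (revcycle c s) r = mixl q s r.
  by move=> rl; apply: eq_big_seq => a /rl/out[ac _]; rewrite cycprod_revcycle_out.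
have sub1 : {subset l1 <= l1 ++ l2} by move=> a al; rewrite mem_cat al.
have sub2 : {subset l2 <= l1 ++ l2} by move=> a al; rewrite mem_cat al orbT.
rewrite !mixE ?l_rev// !mixlS// !mixl_rev// /= ltnn ltnSn cycprod_revcycle// qre_conj.
by rewrite -[LHS]mulrDr -mulrDl qaddconj mulrDl mulrDr.
Qed.

Lemma cycmins_revcycle a s : cycmins (revcycle a s) = cycmins s.
Proof. by apply: eq_filter => b; rewrite porbit_revcycle. Qed.

Lemma mem_cycmins a s : (a \in cycmins s) = cyclemin s a.
Proof. by rewrite mem_filter mem_enum andbT. Qed.

Lemma cyclemin_uniq s a b :
  cyclemin s a -> cyclemin s b -> b \in porbit s a -> b = a.
Proof.
move=> /forall_inP amin /forall_inP bmin ba.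
by apply/val_inj/anti_leq; rewrite amin// bmin// porbit_sym.
Qed.

Lemma hdet_subdet : hdet M = qr (subdet M setT).
Proof.
rewrite /hdet /subdet rmorph_sum.
under eq_bigr do rewrite -[X in _ * X]mulr1.
rewrite sum_cycprod_real//.
- apply: eq_big => [s|s _]; first by apply/esym/subsetP.
  rewrite mulr1 big_filter big_enum_cond; congr (qr (_ * _)).
  by apply: eq_bigl => a; rewrite !inE.
- exact: cycmins_revcycle.
- by move=> s; rewrite filter_uniq// enum_uniq.
- by move=> s a b; rewrite !mem_cycmins; exact: cyclemin_uniq.
Qed.

(** The cycle through [j], which carries [f], is the untouched tail [X] of [sum_cycprod_real]. Once
    the other cycle products are real, their decreasing order no longer matters. *)
Lemma cdet_subcof j (f : 'cV[H]_n) :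
  cdet j (colrep M j f) = subcof M setT j (fun a => f a 0).
Proof.
rewrite /cdet /subcof.
pose l s := [seq a <- rev (cycmins s) | a \notin porbit s j].
have -> : \sum_(s : 'S_n) cycsign R s *
    ((\prod_(a <- rev (cycmins s) | a \notin porbit s j)
      cycprod (colrep M j f) s a) * cycprod (colrep M j f) s j) =
    \sum_(s : 'S_n) cycsign R s * ((\prod_(a <- l s) cycprod M s a)
      * (wprod M s j * f ((s^-1)%g j) 0)).
  apply: eq_bigr => s _; rewrite cycprod_colrep big_filter.
  by congr (_ * (_ * _)); apply: eq_bigr => a; exact: cycprod_colrep_out.
have mem_l s a : (a \in l s) = (a \notin porbit s j) && cyclemin s a.
  by rewrite mem_filter mem_rev mem_cycmins.
rewrite sum_cycprod_real.
- apply: eq_big => [s|s _]; first by apply/esym/subsetP.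
  congr (qr (_ * _) * _); rewrite big_filter (perm_big (cycmins s)) ?perm_rev//=.
  by rewrite big_filter_cond big_enum_cond; apply: eq_bigl => a; rewrite !inE.
- by move=> a s; rewrite /l cycmins_revcycle porbit_revcycle.
- by move=> s; rewrite filter_uniq// rev_uniq filter_uniq// enum_uniq.
- by move=> s a b; rewrite !mem_l => /andP[_ am] /andP[_]; exact: cyclemin_uniq.
- move=> s a; rewrite mem_l porbit_sym => /andP[ja _].
  by rewrite (wprod_agree M (revcycle_agree ja)) (permV_agree (revcycle_agree ja)).
Qed.

End Realization.

(** * Permutations of a subset viewed as permutations of all indices *)

Section ExtendPerm.
Local Open Scope group_scope.
Variables (n : nat) (beta : {set 'I_n}).
Local Notation p := #|beta|.
Local Notation h := (@enum_val _ (mem beta)).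
Implicit Types (s : 'S_p) (k : 'I_p) (x : 'I_n).

(** Monotonicity of the enumeration ensures that cycle minima in the submatrix correspond to cycle
    minima in the large matrix. *)
Lemma enum_val_ltn k1 k2 : (h k1 < h k2)%N = (k1 < k2)%N.
Proof.
have sorted_beta : sorted ltn (map val (enum beta)).
  apply: (subseq_sorted ltn_trans _ (iota_ltn_sorted 0 n)).
  by rewrite -val_enum_ord map_subseq// [enum 'I_n]enumT filter_subseq.
have incr k k' : (k < k')%N -> (h k < h k')%N.
  have in_enum (l : 'I_p) : (l < size (enum beta))%N by rewrite -cardE.
  have x0 : 'I_n := h k.
  move=> lt; rewrite !(enum_val_nth x0).
  rewrite -(nth_map x0 0%N val (in_enum k)) -(nth_map x0 0%N val (in_enum k')).
  by apply: (sorted_ltn_nth ltn_trans) => //; rewrite inE size_map.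
case: (ltngtP k1 k2) => [/incr//|/incr lt|/val_inj ->]; last by rewrite ltnn.
by apply/negbTE; rewrite -leqNgt ltnW.
Qed.

Lemma enum_val_leq k1 k2 : (h k1 <= h k2)%N = (k1 <= k2)%N.
Proof. by rewrite leqNgt enum_val_ltn -leqNgt. Qed.

Lemma enum_valE x : x \in beta -> exists k, x = h k.
Proof. by move=> xb; exists (enum_rank_in xb x); rewrite enum_rankK_in. Qed.

Definition extperm_fun s x := if [pick k | h k == x] is Some k then h (s k) else x.

Lemma extperm_funE s k : extperm_fun s (h k) = h (s k).
Proof.
rewrite /extperm_fun; case: pickP => [k' /eqP/enum_val_inj ->//|/(_ k)].
by rewrite eqxx.
Qed.

Lemma extperm_fun_out s x : x \notin beta -> extperm_fun s x = x.
Proof.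
move=> xb; rewrite /extperm_fun; case: pickP => // k /eqP hk.
by rewrite -hk enum_valP in xb.
Qed.

Fact extperm_inj s : injective (extperm_fun s).
Proof.
move=> x z.
have [/enum_valE[k ->]|xb] := boolP (x \in beta);
  rewrite ?extperm_funE ?(extperm_fun_out _ xb);
have [/enum_valE[k' ->]|zb] := boolP (z \in beta);
  rewrite ?extperm_funE ?(extperm_fun_out _ zb)//.
- by move/enum_val_inj/perm_inj->.
- by move=> hz; rewrite -hz enum_valP in zb.
- by move=> hx; rewrite hx enum_valP in xb.
Qed.

Definition extperm s := perm (@extperm_inj s).

Lemma extpermE s k : extperm s (h k) = h (s k).
Proof. by rewrite permE extperm_funE. Qed.

Lemma extperm_out s x : x \notin beta -> extperm s x = x.
Proof. by rewrite permE; exact: extperm_fun_out. Qed.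

Lemma extpermM s s' : extperm (s * s') = extperm s * extperm s'.
Proof.
apply/permP => x; rewrite permM.
have [/enum_valE[k ->]|xb] := boolP (x \in beta); first by rewrite !extpermE permM.
by rewrite !extperm_out.
Qed.

Lemma extperm_tperm k k' : extperm (tperm k k') = tperm (h k) (h k').
Proof.
apply/permP => x; have [/enum_valE[l ->]|xb] := boolP (x \in beta).
  by rewrite extpermE -(inj_tperm _ _ _ enum_val_inj).
by rewrite extperm_out// tpermD//; apply: contraNneq xb => <-; exact: enum_valP.
Qed.

(** Extension is multiplicative and sends transpositions to transpositions, so a factorization into
    transpositions carries over. *)
Lemma odd_extperm s : extperm s = s :> bool.
Proof.
have [ts -> _] := prod_tpermP s; elim: ts => [|t ts IH].
  rewrite big_nil odd_perm1; suff -> : extperm 1 = 1 by rewrite odd_perm1.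
  apply/permP => x; rewrite perm1.
  have [/enum_valE[l ->]|xb] := boolP (x \in beta); last exact: extperm_out.
  by rewrite extpermE perm1.
rewrite big_cons extpermM extperm_tperm !odd_permM !odd_tperm IH.
by rewrite (inj_eq enum_val_inj).
Qed.

Lemma perm_on_extperm s : perm_on beta (extperm s).
Proof.
by apply/subsetP => x; rewrite inE; apply: contraR => /extperm_out ->.
Qed.

Lemma extperm_injective : injective extperm.
Proof.
move=> s s' e; apply/permP => k; apply: enum_val_inj.
by rewrite -!extpermE e.
Qed.

(** One inclusion is clear; equality follows by counting, as extension is injective and both sets
    have [#|beta|] factorial elements. *)
Lemma extperm_image : [set extperm s | s in setT] = [set u | perm_on beta u].
Proof.
apply/eqP; rewrite eqEcard; apply/andP; split.
  by apply/subsetP => u /imsetP[s _ ->]; rewrite inE perm_on_extperm.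
rewrite card_imset; last exact: extperm_injective.
by rewrite cardsE card_perm cardsT card_Sn.
Qed.

Lemma sum_perm_on (V : nmodType) (F : 'S_n -> V) :
  (\sum_(u | perm_on beta u) F u = \sum_(s : 'S_p) F (extperm s))%R.
Proof.
have -> : (\sum_(u | perm_on beta u) F u =
           \sum_(u in [set extperm s | s in setT]) F u)%R.
  by apply: eq_bigl => u; rewrite extperm_image inE.
rewrite big_imset; last by move=> s s' _ _; exact: extperm_injective.
by apply: eq_bigl => s; rewrite inE.
Qed.

Lemma expg_extperm s t k : (extperm s ^+ t) (h k) = h ((s ^+ t) k).
Proof. by elim: t => [|t IH]; rewrite ?expg0 ?perm1// !expgSx IH extpermE. Qed.

Lemma extpermV s k : (extperm s)^-1 (h k) = h (s^-1 k).
Proof. by apply: (@perm_inj _ (extperm s)); rewrite permKV extpermE permKV. Qed.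

Lemma porbit_extperm s k : porbit (extperm s) (h k) = h @: porbit s k.
Proof.
apply/setP => x; apply/porbitP/imsetP => [[t ->]|[_ /porbitP[t ->] ->]].
  by exists ((s ^+ t) k); rewrite ?mem_porbit// expg_extperm.
by exists t; rewrite expg_extperm.
Qed.

Lemma card_porbit_extperm s k : #|porbit (extperm s) (h k)| = #|porbit s k|.
Proof. by rewrite porbit_extperm card_imset//; exact: enum_val_inj. Qed.

Lemma cyclemin_extperm s k : cyclemin (extperm s) (h k) = cyclemin s k.
Proof.
rewrite /cyclemin porbit_extperm; apply/forall_inP/forall_inP => H b.
  by move=> bs; rewrite -enum_val_leq H// imset_f.
by case/imsetP=> k' k's ->; rewrite enum_val_leq H.
Qed.

Variables (R : realType) (M : 'M[quat R]_n).
Local Open Scope ring_scope.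

Lemma cycprod_extperm s k :
  cycprod M (extperm s) (h k) = cycprod (psubmx M beta) s k.
Proof.
rewrite /cycprod card_porbit_extperm.
by apply: eq_bigr => t _; rewrite mxE !expg_extperm.
Qed.

Lemma wprod_extperm s k :
  wprod M (extperm s) (h k) = wprod (psubmx M beta) s k.
Proof.
rewrite /wprod card_porbit_extperm.
by apply: eq_bigr => t _; rewrite mxE !expg_extperm.
Qed.

Lemma subdet_psubmx : subdet (psubmx M beta) setT = subdet M beta.
Proof.
rewrite /subdet sum_perm_on; apply: eq_big => [s|s _]; first exact/subsetP.
rewrite odd_extperm; congr (_ * _).
rewrite [RHS]big_enum_val_cond; apply: eq_big => [k|k _].
  by rewrite inE cyclemin_extperm.
by rewrite cycprod_extperm.
Qed.

Lemma subcof_psubmx k (f : 'I_n -> quat R) :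
  subcof (psubmx M beta) setT k (fun a => f (h a)) = subcof M beta (h k) f.
Proof.
rewrite /subcof sum_perm_on; apply: eq_big => [s|s _]; first exact/subsetP.
rewrite wprod_extperm extpermV; congr (qr _ * _).
rewrite /outer_weight odd_extperm; congr (_ * _).
rewrite [RHS]big_enum_val_cond; apply: eq_big => [l|l _].
  by rewrite inE cyclemin_extperm porbit_extperm (mem_imset _ _ enum_val_inj).
by rewrite cycprod_extperm.
Qed.

Hypothesis hermM : forall i j, M i j = qconj (M j i).

Lemma hdet_psubmx : hdet (psubmx M beta) = qr (subdet M beta).
Proof. by rewrite hdet_subdet ?subdet_psubmx// => i j; rewrite !mxE hermM. Qed.

Lemma subcdet_subcof j (f : 'cV[quat R]_n) : j \in beta ->
  subcdet j (colrep M j f) beta = subcof M beta j (fun a => f a 0).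
Proof.
move=> /enum_valE[k ->]; rewrite /subcdet; case: pickP => [k'|/(_ k)];
  last by rewrite eqxx.
move=> /eqP/enum_val_inj ->.
have -> : psubmx (colrep M (h k) f) beta =
    colrep (psubmx M beta) k (\col_a f (h a) 0).
  by apply/matrixP => a b; rewrite !mxE (inj_eq enum_val_inj).
rewrite cdet_subcof => [|i j']; last by rewrite !mxE hermM.
rewrite -subcof_psubmx; apply: eq_bigr => s _.
by rewrite mxE.
Qed.
End ExtendPerm.

(** * Normal equations and orthogonality to the kernel *)

Section LeastSquares.
Variable R : realType.
Local Notation H := (quat R).

Lemma qvnorm_sum p (x : 'cV[H]_p) :
  qvnorm x = Num.sqrt (\sum_i qnorm2 (x i 0)).
Proof.
rewrite /qvnorm mxE raddf_sum; congr (Num.sqrt _).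
by apply: eq_bigr => i _; rewrite !mxE qconjmul.
Qed.

Lemma qvnorm_le p q (x : 'cV[H]_p) (z : 'cV[H]_q) :
  (qvnorm x <= qvnorm z) = (\sum_i qnorm2 (x i 0) <= \sum_i qnorm2 (z i 0)).
Proof.
by rewrite !qvnorm_sum ler_sqrt// sumr_ge0// => i _; exact: qnorm2_ge0.
Qed.

(** The cross term is grouped so that, summed over coordinates, it involves [u] and [v] only through
    the inner product of [v] and [u]. *)
Lemma qnorm2D_mulr (u v q : H) : qnorm2 (u + v * q) =
  qnorm2 u + 2 * qre (qconj q * (qconj v * u)) + qnorm2 q * qnorm2 v.
Proof. by rewrite /qnorm2 /=; ring. Qed.

(* Perturbing [u] by [v * q] with [q = - t c], where [c = v^* u], changes the
   square norm by [- t |c|^2 (2 - t |v|^2)]. *)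
Lemma ortho_of_min (I : finType) (u v : I -> H) :
  (forall q, \sum_i qnorm2 (u i) <= \sum_i qnorm2 (u i + v i * q)) ->
  \sum_i qconj (v i) * u i = 0.
Proof.
move=> umin; set c := \sum_i _; pose N := \sum_i qnorm2 (v i).
have N0 : 0 <= N by apply: sumr_ge0 => i _; exact: qnorm2_ge0.
have le q : 0 <= 2 * qre (qconj q * c) + qnorm2 q * N.
  have := umin q; have -> : \sum_i qnorm2 (u i + v i * q) =
      \sum_i qnorm2 (u i) + (2 * qre (qconj q * c) + qnorm2 q * N).
    rewrite (mulr_sumr _ _ _ (qconj q)) raddf_sum !mulr_sumr -!big_split /=.
    by apply: eq_bigr => i _; rewrite qnorm2D_mulr addrA.
  by rewrite lerDl.
(* Any positive [t] with [t * N < 2] would serve; this one also covers [N = 0]. *)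
pose t := (1 + N)^-1.
have t0 : 0 < t by rewrite invr_gt0 ltr_pwDl.
have tN : t * N < 1.
  by rewrite mulrC ltr_pdivrMr ?mul1r ?ltr_pwDl// ltrDr.
have c0 := qnorm2_ge0 c.
have := le (qr (- t) * c); rewrite qconjM qconj_qr -qrC -mulrA qconjmul.
have -> : qnorm2 (qr (- t) * c) = t ^+ 2 * qnorm2 c by rewrite /qnorm2 /=; ring.
rewrite -rmorphM /= => le0.
have : t * qnorm2 c * (2 - t * N) <= 0 by lra.
rewrite pmulr_lle0; last by lra.
rewrite pmulr_rle0// => cle; apply/eqP; rewrite -qnorm2_eq0.
by rewrite eq_le cle c0.
Qed.

Variables (m n : nat) (A : 'M[H]_(m, n)).

(** Changing only coordinate [i] of [x] moves the residual along column [i] of [A]; minimality makes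
    the residual orthogonal to that column. *)
Lemma lsq_normal_eq (y : 'cV[H]_m) (x : 'cV[H]_n) :
  is_lsq A y x -> qadj A *m A *m x = qadj A *m y.
Proof.
move=> xmin; apply/eqP; rewrite -subr_eq0 -mulmxA -mulmxBr; apply/eqP/colP => i.
rewrite [RHS]mxE mxE -[RHS](@ortho_of_min _ (fun r => (A *m x - y) r 0) (A^~ i)).
  by apply: eq_bigr => r _; rewrite !mxE.
move=> q; have := xmin (x + \col_l (if l == i then q else 0)).
rewrite qvnorm_le => /le_trans; apply; rewrite le_eqVlt; apply/orP; left.
apply/eqP; apply: eq_bigr => r _; rewrite mulmxDr addrAC [in LHS]mxE.
congr (qnorm2 (_ + _)); rewrite mxE (bigD1 i)//= mxE eqxx big1 ?addr0//.
by move=> l /negPf li; rewrite mxE li mulr0.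
Qed.

(** Adding a right multiple of a kernel vector keeps [x] a least squares solution, so minimality of
    the norm applies along this direction. *)
Lemma lsq_least_norm_ortho (y : 'cV[H]_m) (x : 'cV[H]_n) (v : 'I_n -> H) :
  is_lsq_least_norm A y x -> (forall r, \sum_l A r l * v l = 0) ->
  \sum_l qconj (v l) * x l 0 = 0.
Proof.
move=> [xlsq xmin] Av; apply: ortho_of_min => q.
pose d : 'cV[H]_n := \col_l (v l * q).
have Ad : A *m d = 0.
  apply/colP => r; rewrite !mxE; under eq_bigr do rewrite mxE mulrA.
  by rewrite -mulr_suml Av mul0r.
have /xmin : is_lsq A y (x + d) by move=> z; rewrite mulmxDr Ad addr0.
rewrite qvnorm_le; under [X in _ <= X -> _]eq_bigr do rewrite !mxE.
by [].
Qed.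
End LeastSquares.

(** * Minors of the Gram matrix, their sign, and the summed Laplace expansion *)

Section GramMinors.
Variables (R : realType) (m n : nat) (A : 'M[quat R]_(m, n)).
Local Notation H := (quat R).
Local Notation G := (qadj A *m A).
Local Notation cof g j l := (subcof G g j (fun a => (a == l)%:R)).
Implicit Types (g : {set 'I_n}) (i j l : 'I_n).

Lemma gramE l i : G l i = \sum_r qconj (A r l) * A r i.
Proof. by rewrite mxE; apply: eq_bigr => r _; rewrite !mxE. Qed.

Lemma gram_herm l i : G l i = qconj (G i l).
Proof.
by rewrite !gramE raddf_sum; apply: eq_bigr => r _; rewrite /= qconjM qconjK.
Qed.

Lemma cof_gram g i j : i \in g -> j \in g ->
  \sum_(l in g) cof g j l * G l i = if i == j then qr (subdet G g) else 0.
Proof.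
move=> ig jg; rewrite -(subcof_linear _ (fun l => G l i) jg).
case: eqVneq => [->|ij]; first exact: (subcof_diag gram_herm).
exact: (subcof_offdiag gram_herm).
Qed.

(** Expanding the form groups it into cofactors of column [j] against column [i] of the Gram matrix.
    The Laplace rules leave only [i = j], where the remaining cofactor is the minor of [g :\ j]. *)
Lemma cof_gram_form g j : j \in g ->
  \sum_r qconj (\sum_(l in g) A r l * qconj (cof g j l))
          * (\sum_(l in g) A r l * qconj (cof g j l))
    = qr (subdet G g * subdet G (g :\ j)).
Proof.
move=> jg.
have -> : qr (subdet G g * subdet G (g :\ j)) =
    \sum_(i in g) (\sum_(l in g) cof g j l * G l i) * qconj (cof g j i).
  rewrite (bigD1 j)//= [X in _ + X]big1 ?addr0 => [|i /andP[ig /negPf ij]].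
    by rewrite cof_gram// eqxx subcof_minor// qconj_qr rmorphM.
  by rewrite cof_gram// ij mul0r.
under [RHS]eq_bigr do rewrite mulr_suml.
under [LHS]eq_bigr do rewrite mulr_sumr.
rewrite exchange_big /=; apply: eq_bigr => i ig.
under [LHS]eq_bigr do rewrite raddf_sum mulr_suml.
rewrite exchange_big /=; apply: eq_bigr => l lg.
rewrite gramE mulr_sumr mulr_suml; apply: eq_bigr => r _.
by rewrite qconjM qconjK !mulrA.
Qed.

(** A relation [a] among the columns in [g] is killed by the Gram block; applying the cofactors of
    [j] to it gives the minor times [a j]. *)
Lemma subdet_dependent g : ~ right_indep A g -> subdet G g = 0.
Proof.
move=> dep; apply/eqP; apply: contra_notT dep => D0 a Aa j jg.
suff /qr_mul_eq0[/eqP|//] : qr (subdet G g) * a j = 0 by rewrite (negPf D0).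
have -> : qr (subdet G g) * a j =
    \sum_(i in g) (\sum_(l in g) cof g j l * G l i) * a i.
  rewrite (bigD1 j)//= [X in _ + X]big1 ?addr0 => [|i /andP[ig /negPf ij]].
    by rewrite cof_gram// eqxx.
  by rewrite cof_gram// ij mul0r.
under eq_bigr do rewrite mulr_suml.
rewrite exchange_big big1// => l lg.
under eq_bigr do rewrite gramE -mulrA mulr_suml mulr_sumr.
rewrite exchange_big big1//= => r _.
under eq_bigr do rewrite -mulrA.
by rewrite -!mulr_sumr Aa !mulr0.
Qed.

Lemma right_indep_sub g g' : g' \subset g -> right_indep A g -> right_indep A g'.
Proof.
move=> /subsetP sub ind a Aa j jg'.
have := ind (fun l => if l \in g' then a l else 0) _ j (sub _ jg').
rewrite jg'; apply=> r; rewrite -[RHS](Aa r) big_mkcond [RHS]big_mkcond.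
apply: eq_bigr => l _; case: ifPn => lg; case: ifPn => lg' //; rewrite ?mulr0//.
by rewrite sub in lg.
Qed.

Lemma subdet_independent_gt0 g : right_indep A g -> 0 < subdet G g.
Proof.
have [k] := ubnP #|g|; elim: k g => // k IH g; rewrite ltnS => gk ind.
have [->|[j jg]] := set_0Vmem g; first by rewrite subdet0.
have minor0 : 0 < subdet G (g :\ j).
  apply: IH; last exact: right_indep_sub (subsetDl _ _) ind.
  by rewrite (leq_trans _ gk)// [X in (_ < X)%N](cardsD1 j) jg.
(* The square norm of [A v] is the minor of [g] times [minor0], so the minor of [g] is nonnegative.
   If it vanished, independence would force [v = 0] on [g], whereas [v] at [j] equals [minor0]. *)
have := qre_sum_conj_mul_ge0 (fun r => \sum_(l in g) A r l * qconj (cof g j l)).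
rewrite cof_gram_form//= => -[]; rewrite pmulr_lge0// le_eqVlt => /predU1P[D0|//].
rewrite -D0 mul0r eqxx => /esym/forallP Av.
have := ind (fun l => qconj (cof g j l)) _ j jg; rewrite subcof_minor// qconj_qr.
case/(_ _)/Wrap => [r|]; first exact/eqP.
by move/qr_inj => M0; rewrite M0 ltxx in minor0.
Qed.

Lemma subdet_gram_ge0 g : 0 <= subdet G g.
Proof.
have [ind|dep] := pselect (right_indep A g).
  exact/ltW/subdet_independent_gt0.
by rewrite subdet_dependent.
Qed.

(** The vanishing minor makes the square norm of [A v] zero for the conjugate cofactors [v];
    extended by zero outside [g], they form a kernel vector. *)
Lemma cof_ortho g j (x : 'I_n -> H) : j \in g -> subdet G g = 0 ->
  (forall v : 'I_n -> H, (forall r, \sum_l A r l * v l = 0) ->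
     \sum_l qconj (v l) * x l = 0) ->
  \sum_(l in g) cof g j l * x l = 0.
Proof.
move=> jg D0 ortho.
have := qre_sum_conj_mul_ge0 (fun r => \sum_(l in g) A r l * qconj (cof g j l)).
rewrite cof_gram_form// D0 mul0r => -[_]; rewrite eqxx => /esym/forallP Av.
rewrite -[RHS](ortho (fun l => if l \in g then qconj (cof g j l) else 0)).
  rewrite big_mkcond; apply: eq_bigr => l _.
  by case: ifP => _; rewrite ?qconjK// raddf0 mul0r.
move=> r; rewrite -[RHS](eqP (Av r)) [RHS]big_mkcond; apply: eq_bigr => l _.
by case: ifP => _; rewrite ?mulr0.
Qed.

Lemma sum_setU1 (V : nmodType) (k : nat) i (P : pred {set 'I_n}) (E : {set 'I_n} -> V) :
  \sum_(g : {set 'I_n} | (#|g| == k.+1) && (i \in g) && P g) E g =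
  \sum_(b : {set 'I_n} | (#|b| == k) && (i \notin b) && P (i |: b)) E (i |: b).
Proof.
rewrite (reindex_onto (fun b => i |: b) (fun g => g :\ i)) /=; last first.
  by move=> g /andP[/andP[_ ig] _]; rewrite setD1K.
apply: eq_bigl => b; rewrite setU11 andbT.
have [ib|ib] := boolP (i \in b); last by rewrite setU1K// cardsU1 ib eqxx !andbT.
rewrite !andbF; apply/negP => /andP[_ /eqP eb].
by rewrite -eb !inE eqxx in ib.
Qed.

(** The hypothesis concerns only sets of size [k.+1], so it is vacuous for [k = n]; both cases of
    the theorem rest on this identity. *)
Lemma sum_subcof_gram k j (x : 'I_n -> H) :
  (forall g, #|g| = k.+1 -> j \in g -> \sum_(l in g) cof g j l * x l = 0) ->
  \sum_(b : {set 'I_n} | (#|b| == k) && (j \in b))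
     subcof G b j (fun a => \sum_i G a i * x i)
  = qr (\sum_(b : {set 'I_n} | #|b| == k) subdet G b) * x j.
Proof.
move=> cof0.
(* Among the columns in [b] only column [j] contributes; a column [i] outside [b] contributes minus
   a cofactor of [i |: b]. *)
have expand (b : {set 'I_n}) : j \in b -> subcof G b j (fun a => \sum_i G a i * x i) =
    qr (subdet G b) * x j - \sum_(i | i \notin b) cof (i |: b) j i * x i.
  move=> jb; have -> : subcof G b j (fun a => \sum_i G a i * x i) =
      \sum_i subcof G b j (fun a => G a i) * x i.
    rewrite /subcof; under [RHS]eq_bigr do rewrite mulr_suml.
    rewrite exchange_big /=; apply: eq_bigr => s _.
    by rewrite !mulr_sumr; apply: eq_bigr => i _; rewrite !mulrA.
  rewrite (bigID (fun i => i \in b)) /=; congr (_ + _).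
    rewrite (bigD1 j)//= (subcof_diag gram_herm)// big1 ?addr0//.
    by move=> i /andP[ib ij]; rewrite (subcof_offdiag gram_herm)// mul0r.
  rewrite -sumrN; apply: eq_bigr => i ib.
  rewrite subcof_remove ?setU11//; last 2 first.
  - by rewrite inE jb orbT.
  - by apply: contraNneq ib => ->.
  by rewrite setU1K// mulNr opprK.
under eq_bigr => b /andP[_ jb] do rewrite expand//.
rewrite sumrB (rmorph_sum (@qr R)) mulr_suml.
rewrite [RHS](bigID (fun b : {set 'I_n} => j \in b)) /=.
congr (_ + _); apply/eqP; rewrite eqr_oppLR -sumrN; apply/eqP.
(* A [k]-set [b] containing [j] with an index [i] outside it is the same as a set [g = i |: b] of
   size [k.+1] containing [j] with a marked [i != j]. *)
transitivity (\sum_(g : {set 'I_n} | (#|g| == k.+1) && (j \in g))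
   \sum_(i in g | i != j) cof g j i * x i).
  rewrite (exchange_big_dep predT)//= [RHS](exchange_big_dep predT)//=.
  apply: eq_bigr => i _.
  rewrite [RHS](eq_bigl (fun g : {set 'I_n} =>
    (#|g| == k.+1) && (i \in g) && ((j \in g) && (i != j)))).
    rewrite sum_setU1; apply: eq_bigl => b.
    rewrite !inE [j == i]eq_sym; have [->|_] := eqVneq i j; last first.
      by rewrite !andbT /= -!andbA; congr (_ && _); rewrite andbC.
    by rewrite !andbF -andbA; case: (j \in b); rewrite ?andbF.
  by move=> g; rewrite -!andbA; congr (_ && _); rewrite andbCA.
have tr : \sum_(b : {set 'I_n} | (#|b| == k) && (j \notin b))
     - (qr (subdet G b) * x j) =
   \sum_(g : {set 'I_n} | (#|g| == k.+1) && (j \in g)) - (qr (subdet G (g :\ j)) * x j).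
  have := sum_setU1 k j predT (fun g => - (qr (subdet G (g :\ j)) * x j)).
  rewrite (eq_bigl _ _ (fun g => andbT _)) => ->; apply: eq_big => [b|b /andP[_ jb]].
    by rewrite andbT.
  by rewrite setU1K.
rewrite tr; apply: eq_bigr => g /andP[/eqP gk jg].
(* The term at [j] of the vanishing sum over [g] is the minor of [g :\ j] times [x j], so the other
   terms add up to its opposite. *)
have := cof0 g gk jg; rewrite (bigD1 j)//= subcof_minor// => /eqP.
by rewrite addrC addr_eq0 => /eqP.
Qed.

Lemma qrank_indep : exists2 g : {set 'I_n}, #|g| = qrank A & right_indep A g.
Proof.
have [|g /asboolP ind gE] := @eq_bigmax_cond _
    [pred S : {set 'I_n} | `[< right_indep A S >]] (fun S => #|S|).
  (* The empty set is independent, so the maximum runs over a nonempty family and is attained. *)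
  apply/card_gt0P; exists set0; rewrite inE; apply/asboolP => a _ j.
  by rewrite inE.
by exists g.
Qed.

Lemma qrank_max g : right_indep A g -> (#|g| <= qrank A)%N.
Proof. by move=> ind; apply: leq_bigmax_cond; apply/asboolP. Qed.

End GramMinors.

(** * Cramer's rule at full rank and at rank [k] *)

Theorem theorem5p3 (R : realType) (m n : nat) (A : 'M[quat R]_(m, n))
    (y : 'cV[quat R]_m) (x0 : 'cV[quat R]_n) :
  is_lsq_least_norm A y x0 ->
  let f := qadj A *m y in
  (qrank A = n ->
     forall j : 'I_n,
       x0 j 0 = cdet j (colrep (qadj A *m A) j f) * qinv (ddet A)) /\
  (forall k : nat, qrank A = k -> (k <= m)%N -> (m < n)%N ->
     forall j : 'I_n,
       x0 j 0 =
         (\sum_(beta : {set 'I_n} | (#|beta| == k) && (j \in beta))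
             subcdet j (colrep (qadj A *m A) j f) beta)
         * qinv (\sum_(beta : {set 'I_n} | #|beta| == k)
                   hdet (psubmx (qadj A *m A) beta))).
Proof.
move=> x0_min f; have hermG := gram_herm A.
have fE a : f a 0 = \sum_i (qadj A *m A) a i * x0 i 0.
  by rewrite /f -(lsq_normal_eq x0_min.1) mxE.
have subcof_f g j : subcof (qadj A *m A) g j (fun a => f a 0) =
    subcof (qadj A *m A) g j (fun a => \sum_i (qadj A *m A) a i * x0 i 0).
  by apply: eq_bigr => s _; rewrite fE.
have quotient (d : R) j : d != 0 -> x0 j 0 = qr d * x0 j 0 * qinv (qr d).
  by move=> d0; rewrite qr_qinv -qrC mulrA -rmorphM mulVf// mul1r.
split=> [rank_n j|k rank_k _ _ j].
  have [g gn ind] := qrank_indep A.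
  have gT : g = setT.
    by apply/eqP; rewrite eqEcard subsetT cardsT card_ord gn rank_n leqnn.
  rewrite /ddet hdet_subdet// cdet_subcof// subcof_f.
  rewrite {1}(quotient (subdet (qadj A *m A) setT)).
    have le_n (b : {set 'I_n}) : (#|b| <= n)%N.
      by rewrite -[X in (_ <= X)%N]card_ord max_card.
    (* At full rank the sums over [n]-sets reduce to the full set, and no set of size [n.+1]
       exists. *)
    have oneT (b : {set 'I_n}) : (#|b| == n) = (b == setT).
      by rewrite eqEcard subsetT cardsT card_ord eqn_leq le_n.
    congr (_ * _).
    have := @sum_subcof_gram _ _ _ A n j (fun i => x0 i 0).
    rewrite (eq_bigl (pred1 setT)) => [|b]; last first.
      by rewrite oneT /=; case: eqP => // ->; rewrite inE.
    rewrite (eq_bigl _ _ oneT) !big_pred1_eq => -> // b bn.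
    by have := le_n b; rewrite bn ltnn.
  by rewrite gt_eqF// -gT subdet_independent_gt0.
under eq_bigr => b /andP[_ jb] do rewrite subcdet_subcof// subcof_f.
under [X in qinv X]eq_bigr do rewrite hdet_psubmx//.
rewrite -rmorph_sum /= sum_subcof_gram; last first.
  (* A set larger than the rank has dependent columns, so its minor vanishes. *)
  move=> g gk jg; apply: cof_ortho => // [|v Av];
    last exact: lsq_least_norm_ortho x0_min Av.
  by apply: subdet_dependent => /qrank_max; rewrite gk rank_k ltnn.
(* The denominator is positive: all minors are nonnegative, and that of an independent set of size
   [k] is positive. *)
apply: quotient; have [g gk ind] := qrank_indep A.
rewrite gt_eqF// (bigD1 g) ?gk ?rank_k//= ltr_pwDl ?subdet_independent_gt0//.
by apply: sumr_ge0 => b _; exact: subdet_gram_ge0.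
Qed.
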